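(* Let $(\mathcal{A},\mathbb{E},\varepsilon)$ be a Banach $\mathcal{B}$-$\mathcal{B}$-non-commutative probability space, and let $Z_\ell\in\mathcal{A}_\ell$ and $Z_r\in\mathcal{A}_r$. The operator-valued bi-Boolean partial $\eta$-transform $\eta_{(Z_\ell,Z_r)}$ of $(Z_\ell,Z_r)$ is given by $$\eta_{(Z_\ell,Z_r)}(b,d)=\eta^\ell_{Z_\ell}(b)+\eta^r_{Z_r}(d)+M^\ell_{Z_\ell}(b)^{-1}\,M_{(Z_\ell,Z_r)}(b,d)\,M^r_{Z_r}(d)^{-1}-1$$ for $b,d\in\mathcal{B}$ sufficiently small.
   Context: $\mathcal{B}$ is a unital algebra over $\mathbb{C}$. A $\mathcal{B}$-$\mathcal{B}$-non-commutative probability space is a triple $(\mathcal{A},\mathbb{E},\varepsilon)$ where $\mathcal{A}$ is a unital complex algebra, $\varepsilon:\mathcal{B}\otimes\mathcal{B}^{\mathrm{op}}\to\mathcal{A}$ is a unital homomorphism with $\varepsilon|_{\mathcal{B}\otimes1_{\mathcal{B}}}$ and $\varepsilon|_{1_{\mathcal{B}}\otimes\mathcal{B}^{\mathrm{op}}}$ injective, and $\mathbb{E}:\mathcal{A}\to\mathcal{B}$ is a unital linear map with $\mathbb{E}(\varepsilon(b_1\otimes b_2)Z)=b_1\mathbb{E}(Z)b_2$ and $\mathbb{E}(Z\varepsilon(b\otimes1_{\mathcal{B}}))=\mathbb{E}(Z\varepsilon(1_{\mathcal{B}}\otimes b))$ for all $b_1,b_2,b\in\mathcal{B}$, $Z\in\mathcal{A}$.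 It is a Banach $\mathcal{B}$-$\mathcal{B}$-non-commutative probability space if $\mathcal{A}$ and $\mathcal{B}$ are Banach algebras and $\mathbb{E}$, $\varepsilon|_{\mathcal{B}\otimes1_{\mathcal{B}}}$, $\varepsilon|_{1_{\mathcal{B}}\otimes\mathcal{B}^{\mathrm{op}}}$ are bounded. Write $L_b=\varepsilon(b\otimes1_{\mathcal{B}})$ and $R_b=\varepsilon(1_{\mathcal{B}}\otimes b)$. $\mathcal{A}_\ell$ is the set of $Z\in\mathcal{A}$ commuting with all $R_b$, and $\mathcal{A}_r$ the set of $Z\in\mathcal{A}$ commuting with all $L_b$, $b\in\mathcal{B}$. For $\chi:\{1,\dots,n\}\to\{\ell,r\}$ with $\chi^{-1}(\{\ell\})=\{i_1<\cdots<i_p\}$ and $\chi^{-1}(\{r\})=\{i_{p+1}>\cdots>i_n\}$, let $\prec_\chi$ be the total order $i_1\prec_\chi\cdots\prec_\chi i_n$. $\mathrm{BI}(\chi)$ is the lattice (under refinement $\le$) of partitions of $\{1,\dots,n\}$ all of whose blocks are intervals for $\prec_\chi$, with maximal element $1_\chi$; its Möbius function is $\mu_{\mathrm{BI}}(\sigma,\pi)=(-1)^{|\sigma|-|\pi|}$ for $\sigma\le\pi$. For $Z_j\in\mathcal{A}_{\chi(j)}$ and $\pi\in\mathrm{BI}(\chi)$ with blocks $V_1,\dots,V_m$ ordered by $\prec_\chi$, $\mathcal{E}_\pi(Z_1,\dots,Z_n)=\mathbb{E}(Z_{V_1})\cdots\mathbb{E}(Z_{V_m})$, where $Z_V=Z_{v_1}\cdots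 Z_{v_s}$ for $V=\{v_1<\cdots<v_s\}$; the operator-valued bi-Boolean cumulant function is $B_\pi(Z_1,\dots,Z_n)=\sum_{\sigma\in\mathrm{BI}(\chi),\,\sigma\le\pi}\mathcal{E}_\sigma(Z_1,\dots,Z_n)\mu_{\mathrm{BI}}(\sigma,\pi)$. $\chi_{m,n}:\{1,\dots,m+n\}\to\{\ell,r\}$ is $\ell$ on $\{1,\dots,m\}$ and $r$ on $\{m+1,\dots,m+n\}$. For $b,d\in\mathcal{B}$ near $0$ (where all these series converge absolutely and $M^\ell_{Z_\ell}(b)$, $M^r_{Z_r}(d)$ are invertible), define $$M^\ell_{Z_\ell}(b)=1+\sum_{m\ge1}\mathbb{E}((L_bZ_\ell)^m),\qquad M^r_{Z_r}(d)=1+\sum_{n\ge1}\mathbb{E}((R_dZ_r)^n),$$ $$\eta^\ell_{Z_\ell}(b)=\sum_{m\ge1}B_{1_{\chi_{m,0}}}(L_bZ_\ell,\dots,L_bZ_\ell),\qquad \eta^r_{Z_r}(d)=\sum_{n\ge1}B_{1_{\chi_{0,n}}}(R_dZ_r,\dots,R_dZ_r),$$ $$M_{(Z_\ell,Z_r)}(b,d)=1+\sum_{m,n\ge0,\,m+n\ge1}\mathbb{E}((L_bZ_\ell)^m(R_dZ_r)^n),$$ $$\eta_{(Z_\ell,Z_r)}(b,d)=\sum_{m,n\ge0,\,m+n\ge1}B_{1_{\chi_{m,n}}}(\underbrace{L_bZ_\ell,\dots,L_bZ_\ell}_{m\text{ times}},\underbrace{R_dZ_r,\dots,R_dZ_r}_{n\text{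 times}}).$$ *)

(* Defs.v *)
From HB Require Import structures.
From mathcomp Require Import all_boot all_order all_algebra.
From mathcomp Require Import finmap complex.
From mathcomp Require Import boolp classical_sets reals topology normedtype.
From mathcomp Require summability.

Set Implicit Arguments.
Unset Strict Implicit.
Unset Printing Implicit Defensive.

Import Order.TTheory GRing.Theory Num.Theory.
Import numFieldNormedType.Exports.

Local Open Scope ring_scope.

(* Unital (nontrivial) Banach algebras over [K]; the norm of the unit is not
   required to be 1. This is a record over [completeNormedModType], and not a
   Hierarchy-Builder structure, because the library has no join of normed
   modules and rings below [numDomainType]. The algebra structure is then
   declared on the carrier. *)
Record banachAlgType (K : numFieldType) := BanachAlgType {
  banach_space : completeNormedModType K;
  banach_one : banach_space;
  banach_mul : banach_space -> banach_space -> banach_space;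
  banach_mulA : associative banach_mul;
  banach_mul1l : left_id banach_one banach_mul;
  banach_mul1r : right_id banach_one banach_mul;
  banach_mulDl : left_distributive banach_mul +%R;
  banach_mulDr : right_distributive banach_mul +%R;
  banach_one_neq0 : banach_one != 0;
  banach_scaleAl : forall (k : K) (x y : banach_space),
    k *: banach_mul x y = banach_mul (k *: x) y;
  banach_scaleAr : forall (k : K) (x y : banach_space),
    k *: banach_mul x y = banach_mul x (k *: y);
  banach_norm_mul : forall x y : banach_space,
    `|banach_mul x y| <= `|x| * `|y|
}.

Definition banach_sort (K : numFieldType) (A : banachAlgType K) : Type :=
  banach_space A.
Coercion banach_sort : banachAlgType >-> Sortclass.

Section BanachAlgInstances.
Variables (K : numFieldType) (A : banachAlgType K).

HB.instance Definition _ := CompleteNormedModule.on (banach_sort A).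
HB.instance Definition _ := GRing.Zmodule_isNzRing.Build (banach_sort A)
  (@banach_mulA K A) (@banach_mul1l K A) (@banach_mul1r K A)
  (@banach_mulDl K A) (@banach_mulDr K A) (@banach_one_neq0 K A).
HB.instance Definition _ := GRing.Lmodule_isLalgebra.Build K (banach_sort A)
  (@banach_scaleAl K A).
HB.instance Definition _ := GRing.Lalgebra_isAlgebra.Build K (banach_sort A)
  (@banach_scaleAr K A).

Definition is_inverse (x y : banach_sort A) : Prop := y * x = 1 /\ x * y = 1.

(* Units are the two-sided invertible elements; as everywhere in the library,
   [x^-1] is [x] when [x] is not a unit. *)
Definition banach_unit : pred (banach_sort A) :=
  fun x => `[< exists y, is_inverse x y >].
Definition banach_inv (x : banach_sort A) : banach_sort A :=
  xget x [set y | is_inverse x y]%classic.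

Lemma banach_invP x : banach_unit x -> is_inverse x (banach_inv x).
Proof. by move=> /asboolP[y xy]; apply: (@xgetPex _ x (is_inverse x)); exists y. Qed.

Fact banach_mulVr : {in banach_unit, left_inverse 1 banach_inv *%R}.
Proof. by move=> x /banach_invP[]. Qed.

Fact banach_mulrV : {in banach_unit, right_inverse 1 banach_inv *%R}.
Proof. by move=> x /banach_invP[]. Qed.

Fact banach_unitP (x y : banach_sort A) :
  y * x = 1 /\ x * y = 1 -> banach_unit x.
Proof. by move=> xy; apply/asboolP; exists y. Qed.

Fact banach_inv_out : {in [predC banach_unit], banach_inv =1 id}.
Proof.
move=> x; rewrite inE => /asboolP xN; rewrite /banach_inv xgetPN // => y xy.
by apply: xN; exists y.
Qed.

HB.instance Definition _ := GRing.NzRing_hasMulInverse.Build (banach_sort A)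
  banach_mulVr banach_mulrV banach_unitP banach_inv_out.

End BanachAlgInstances.

Definition bounded_map (K : numFieldType) (V W : normedModType K)
    (f : V -> W) : Prop :=
  exists M : K, forall x : V, `|f x| <= M * `|x|.

Definition bilinear_map (K : fieldType) (U V W : lmodType K)
    (f : U -> V -> W) : Prop :=
  (forall v : V, linear (f^~ v)) /\ (forall u : U, linear (f u)).

(* [T], with the pure tensors [tens b1 b2], is the algebra B (x) B^op: the
   tensor product of vector spaces, characterized by its universal property,
   with (a1 (x) a2) (b1 (x) b2) = (a1 b1) (x) (b2 a2), the second factor being
   multiplied in B^op. *)
Record is_tensor_op (K : fieldType) (B T : algType K)
    (tens : B -> B -> T) : Prop := IsTensorOp {
  tens_bilinear : bilinear_map tens;
  tens_lift : forall (V : lmodType K) (f : B -> B -> V), bilinear_map f ->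
    exists g : {linear T -> V}, forall b1 b2 : B, g (tens b1 b2) = f b1 b2;
  tens_lift_uniq : forall (V : lmodType K) (g h : {linear T -> V}),
    (forall b1 b2 : B, g (tens b1 b2) = h (tens b1 b2)) ->
    forall t : T, g t = h t;
  tens_one : tens 1 1 = 1;
  tens_mul : forall a1 a2 b1 b2 : B,
    tens a1 a2 * tens b1 b2 = tens (a1 * b1) (b2 * a2)
}.

(* B-B-non-commutative probability space (A, E, eps). *)
Record ncps (K : fieldType) (B A : algType K) := Ncps {
  ncps_tensor : algType K;
  ncps_tens : B -> B -> ncps_tensor;
  ncps_tensP : is_tensor_op ncps_tens;
  ncps_eps : {lrmorphism ncps_tensor -> A};
  ncps_epsl_inj : injective (fun b : B => ncps_eps (ncps_tens b 1));
  ncps_epsr_inj : injective (fun b : B => ncps_eps (ncps_tens 1 b));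
  ncps_E : {linear A -> B};
  ncps_E1 : ncps_E 1 = 1;
  ncps_E_bimod : forall (b1 b2 : B) (Z : A),
    ncps_E (ncps_eps (ncps_tens b1 b2) * Z) = b1 * ncps_E Z * b2;
  ncps_E_right : forall (b : B) (Z : A),
    ncps_E (Z * ncps_eps (ncps_tens b 1)) = ncps_E (Z * ncps_eps (ncps_tens 1 b))
}.

Section Ncps.
Context {K : fieldType} {B A : algType K}.
Variable S : ncps B A.

Definition opL (b : B) : A := ncps_eps S (ncps_tens S b 1).
Definition opR (b : B) : A := ncps_eps S (ncps_tens S 1 b).

Definition left_face (Z : A) : Prop := forall b : B, Z * opR b = opR b * Z.
Definition right_face (Z : A) : Prop := forall b : B, Z * opL b = opL b * Z.

End Ncps.

Definition banach_ncps (K : numFieldType) (B A : banachAlgType K)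
    (S : ncps B A) : Prop :=
  [/\ bounded_map (ncps_E S), bounded_map (opL S) & bounded_map (opR S)].

(* Indices are 0-based: {1, ..., n} is represented by 'I_n. *)

Inductive side := Left | Right.

Definition is_left (s : side) : bool := if s is Left then true else false.

Section BiInterval.
Context {n : nat}.
Variable chi : 'I_n -> side.

(* The elements of 'I_n in increasing order for the total order prec_chi. *)
Definition chi_seq : seq 'I_n :=
  [seq i <- enum 'I_n | is_left (chi i)] ++
  rev [seq i <- enum 'I_n | ~~ is_left (chi i)].

Definition chi_lt (i j : 'I_n) : bool := (index i chi_seq < index j chi_seq)%N.

Definition chi_interval (V : {set 'I_n}) : bool :=
  [forall i in V, forall k in V, forall j,
    (chi_lt i j && chi_lt j k) ==> (j \in V)].

Definition BI : {set {set {set 'I_n}}} :=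
  [set pi | finset.partition pi [set: 'I_n] & [forall V in pi, chi_interval V]].

Definition refines (sigma pi : {set {set 'I_n}}) : bool :=
  [forall V in sigma, exists W in pi, V \subset W].

Definition BI_top : {set {set 'I_n}} := [set [set: 'I_n]].

(* The blocks of [pi] in the order prec_chi: the blocks of a bi-interval
   partition occupy consecutive positions of [chi_seq]. *)
Definition chi_blocks (pi : {set {set 'I_n}}) : seq {set 'I_n} :=
  undup [seq finset.pblock pi i | i <- chi_seq].

(* The closed form of the Moebius function of BI(chi) for sigma <= pi, in which
   case #|pi| <= #|sigma| and the subtraction is exact. *)
Definition BI_mobius (K : nzRingType) (sigma pi : {set {set 'I_n}}) : K :=
  (-1) ^+ (#|sigma| - #|pi|).

Context {K : fieldType} {B A : algType K}.
Variable S : ncps B A.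

(* [\prod_(v in V)] multiplies in increasing order of the indices [v]. *)
Definition moment_part (pi : {set {set 'I_n}}) (Z : 'I_n -> A) : B :=
  \prod_(V <- chi_blocks pi) ncps_E S (\prod_(v in V) Z v).

Definition biBoolean (pi : {set {set 'I_n}}) (Z : 'I_n -> A) : B :=
  \sum_(sigma in BI | refines sigma pi)
    moment_part sigma Z * BI_mobius B sigma pi.

End BiInterval.

Definition chi_mn (m n : nat) (i : 'I_(m + n)) : side :=
  if (i < m)%N then Left else Right.

(* B_{1_{chi_{m,n}}} (X, ..., X, Y, ..., Y) with m arguments X and n arguments Y *)
Definition biBoolean_mn (K : fieldType) (B A : algType K) (S : ncps B A)
    (X Y : A) (m n : nat) : B :=
  biBoolean (@chi_mn m n) S BI_top
    (fun i => if is_left (chi_mn i) then X else Y).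

(* Absolute convergence of a family, and (for such families) its sum as the
   limit of the finite partial sums along the directed set of finite subsets. *)
Definition abs_summable (K : numFieldType) (V : normedModType K)
    (I : choiceType) (x : I -> V) : Prop :=
  exists M : K, forall J : {fset I},
    summability.partial_sum (fun i => `|x i|) J <= M.

Notation family_sum := summability.sum.

Section Transforms.
Context {K : numFieldType} {B A : banachAlgType K}.
Variable S : ncps B A.
Variables Zl Zr : A.

Definition Ml_term (b : B) (m : nat) : B := ncps_E S ((opL S b * Zl) ^+ m.+1).
Definition Mr_term (d : B) (n : nat) : B := ncps_E S ((opR S d * Zr) ^+ n.+1).

Definition etal_term (b : B) (m : nat) : B :=
  biBoolean_mn S (opL S b * Zl) 0 m.+1 0.
Definition etar_term (d : B) (n : nat) : B :=
  biBoolean_mn S 0 (opR S d * Zr) 0 n.+1.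

(* The term of index (0, 0) is set to 0: the double series are over m + n >= 1. *)
Definition M_term (b d : B) (p : nat * nat) : B :=
  if p == (0%N, 0%N) then 0
  else ncps_E S ((opL S b * Zl) ^+ p.1 * (opR S d * Zr) ^+ p.2).
Definition eta_term (b d : B) (p : nat * nat) : B :=
  if p == (0%N, 0%N) then 0
  else biBoolean_mn S (opL S b * Zl) (opR S d * Zr) p.1 p.2.

Definition Ml (b : B) : B := 1 + family_sum (Ml_term b).
Definition Mr (d : B) : B := 1 + family_sum (Mr_term d).
Definition etal (b : B) : B := family_sum (etal_term b).
Definition etar (d : B) : B := family_sum (etar_term d).
Definition M_pair (b d : B) : B := 1 + family_sum (M_term b d).
Definition eta_pair (b d : B) : B := family_sum (eta_term b d).

(* (b, d) is in the common domain of the transforms: all the series converge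
   absolutely and the one-variable moment series are invertible. *)
Definition transforms_defined (b d : B) : Prop :=
  [/\ abs_summable (Ml_term b), abs_summable (Mr_term d),
      abs_summable (etal_term b) & abs_summable (etar_term d)] /\
  [/\ abs_summable (M_term b d), abs_summable (eta_term b d),
      Ml b \is a GRing.unit & Mr d \is a GRing.unit].

End Transforms.

(* Main.v *)
(* Put X = L_b Z_l and Y = R_d Z_r. Grouping the interval partitions by their
   first block shows that f(p, q) := - B_{p,q} (with f(0, 0) := 1) satisfies, for
   p + q > 0,
     sum_{0 <= a <= p} E(X^a) f(p - a, q)
       + sum_{1 <= c <= q} E(X^p Y^c) f(0, q - c) = 0,
   because a first block which meets the right part contains the whole left
   part, and what remains is on the right. Summing over p and q, with
   F = 1 - eta and W the sum of the f(0, q), gives M^l F + (M - M^l) W = 1. The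
   one-variable cases of the recursion say that 1 - eta^l is the inverse of M^l
   and that W = 1 - eta^r is the inverse of M^r; solving for F is the claim. The
   recursion also bounds f geometrically for small b and d, which justifies the
   rearrangements. *)
Require Import Defs.
From mathcomp Require Import all_boot all_order all_algebra.

Set Implicit Arguments.
Unset Strict Implicit.
Unset Printing Implicit Defensive.

Import GRing.Theory.
Local Open Scope ring_scope.

(** * Interval partitions of a sequence *)

Section IntervalPartitions.
Variable T : finType.
Implicit Types (s l : seq T) (P : {set {set T}}) (V : {set T}) (x y : T).

(** For [s = chi_seq chi] this is [chi_interval chi]; arbitrary sequences are allowed so that the
    points left after removing the first block form an instance again. *)
Definition seq_interval s V : bool :=
  [forall i in V, forall k in V, forall j,
    ((index i s < index j s) && (index j s < index k s))%N ==> (j \in V)].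

Definition interval_partitions s : {set {set {set T}}} :=
  [set P | finset.partition P [set x in s] & [forall V in P, seq_interval s V]].

Definition seq_blocks s P : seq {set T} := undup [seq finset.pblock P x | x <- s].

Lemma seq_intervalP s V :
  reflect (forall x y z, x \in V -> z \in V ->
             (index x s < index y s)%N -> (index y s < index z s)%N -> y \in V)
          (seq_interval s V).
Proof.
apply: (iffP forall_inP) => [h x y z xV zV xy yz|h x xV].
  by move/forall_inP: (h x xV) => /(_ z zV) /forallP /(_ y); rewrite xy yz.
apply/forall_inP => z zV; apply/forallP => y; apply/implyP => /andP[].
exact: h.
Qed.

Lemma seq_interval_take s k : uniq s -> seq_interval s [set x in take k s].
Proof.
move=> us; apply/seq_intervalP => x y z _; rewrite !inE => zt _ yz.
have zs : z \in s by apply: mem_take zt.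
have ys : y \in s.
  by rewrite -index_mem (ltn_trans yz) // index_mem.
rewrite in_take // (ltn_trans yz) //.
by rewrite -in_take.
Qed.

(** Indices in [s] are all shifted by [size l], and a point of [l] precedes all of [s], so it never
    lies between two points of [V]. *)
Lemma seq_interval_catr l s V : V \subset [set x in s] -> uniq (l ++ s) ->
  seq_interval (l ++ s) V = seq_interval s V.
Proof.
move=> Vs; rewrite cat_uniq => /and3P[_ /hasPn ls _].
have idx x : x \in s -> index x (l ++ s) = (size l + index x s)%N.
  by move=> xs; rewrite index_cat (negPf (ls _ xs)).
have inV x : x \in V -> x \in s by move=> /(subsetP Vs); rewrite inE.
apply/seq_intervalP/seq_intervalP => h x y z xV zV xy yz;
    have [xs zs] := (inV _ xV, inV _ zV).
  have ys : y \in s by rewrite -index_mem (ltn_trans yz) // index_mem.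
  by apply: (h x y z) => //; rewrite !idx // ltn_add2l.
have yl : y \notin l.
  apply/negP => yl; move: xy; rewrite idx // index_cat yl => xy.
  move: yl; rewrite -index_mem => /ltnW.
  by rewrite leqNgt (leq_ltn_trans (leq_addr _ _) xy).
move: xy yz; rewrite !index_cat (negPf (ls _ xs)) (negPf (ls _ zs)) (negPf yl) !ltn_add2l.
exact: (h x y z).
Qed.

(** An interval that contains the first point is an initial segment. *)
Lemma first_block x s P : uniq (x :: s) -> P \in interval_partitions (x :: s) ->
  exists2 k, (k <= size s)%N &
    finset.pblock P x = [set y in x :: take k s].
Proof.
move=> us; rewrite inE => /andP[Pp /forall_inP Pi].
have cP := cover_partition Pp.
have xc : x \in cover P by rewrite cP !inE eqxx.
have VP := pblock_mem xc.
have xV : x \in pblock P x by rewrite mem_pblock.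
set V := pblock P x in VP xV *.
have Vi := seq_intervalP _ _ (Pi _ VP).
(* The first position of [s] outside the block, or [size s] if there is none. *)
pose k := find (fun y => y \notin V) s.
exists k; first exact: find_size.
apply/setP => y; rewrite !inE.
have [->//|yx] /= := eqVneq y x.
have xy_idx z : z != x -> index z (x :: s) = (index z s).+1.
  by move=> zx /=; rewrite eq_sym (negPf zx).
have xs : x \notin s by case/andP: us.
apply/idP/idP => [yV|yt]; last first.
  have : all (mem V) (take k s).
    apply/(all_nthP x) => i; rewrite size_take_min => ik.
    have ik' : (i < k)%N by apply: leq_trans ik (geq_minl _ _).
    rewrite nth_take //; apply: negbFE.
    by rewrite /= (before_find x ik').
  by move/allP/(_ _ yt).
have ys : y \in s.
  by have := subsetP (partitionS Pp VP) y yV; rewrite !inE (negPf yx).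
rewrite in_take //; rewrite ltnNge; apply/negP => ky.
have ksz : (k < size s)%N by apply: leq_ltn_trans ky _; rewrite index_mem.
(* If [y] came at position [k] or later, the [k]-th point, which is outside the block, would be [y]
   itself or lie between [x] and [y]. *)
have hs : has (fun y => y \notin V) s by rewrite has_find.
have := nth_find x hs; rewrite -/k => zV.
have zs : nth x s k \in s by rewrite mem_nth.
have zx : nth x s k != x by apply: contraNneq xs => <-.
have us' : uniq s by case/andP: us.
move: ky; rewrite leq_eqVlt => /orP[/eqP ky|ky].
  by move: zV; rewrite ky nth_index // yV.
move: zV; rewrite (Vi x _ y xV yV) //.
  by rewrite [index x _]/= eqxx xy_idx.
by rewrite !xy_idx // index_uniq.
Qed.

Lemma size_seq_blocks s P : finset.partition P [set x in s] ->
  size (seq_blocks s P) = #|P|.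
Proof.
move=> Pp; rewrite -(card_uniqP (undup_uniq _)); apply: eq_card => V.
rewrite mem_undup; apply/mapP/idP => [[x xs ->]|VP].
  by apply: pblock_mem; rewrite (cover_partition Pp) inE.
have /set0Pn[x xV] := partition_neq0 Pp VP.
exists x; last by rewrite (def_pblock (partition_trivIset Pp) VP xV).
by move: (subsetP (partitionS Pp VP) x xV); rewrite inE.
Qed.

(** [undup] keeps last occurrences; since [v] does not recur in [l], it stays in front. *)
Lemma undup_nseq_cat (U : eqType) (v : U) n (l : seq U) :
  v \notin l -> undup (nseq n.+1 v ++ l) = v :: undup l.
Proof.
move=> vl; elim: n => [|n IHn] /=; first by rewrite (negPf vl).
by rewrite mem_head.
Qed.

(** * Splitting off the first block *)

Section FirstBlock.
Variables (x : T) (s1 s2 : seq T).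
Hypothesis us : uniq ((x :: s1) ++ s2).
Let V := [set y in x :: s1].

Let dis : [disjoint V & [set y in s2]].
Proof.
move: us; rewrite cat_uniq => /and3P[_ /hasPn h _].
rewrite disjoint_sym disjoint_subset; apply/subsetP => y; rewrite !inE => ys2.
by have := h _ ys2; rewrite /= inE.
Qed.

Let V0 : V != set0.
Proof. by apply/set0Pn; exists x; rewrite !inE eqxx. Qed.

Let setsE : [set y in (x :: s1) ++ s2] = V :|: [set y in s2].
Proof. by apply/setP => y; rewrite in_setU !in_set mem_cat. Qed.

Let VnP P : finset.partition P [set y in s2] -> V \notin P.
Proof.
move=> Pp; apply/negP => VP.
have xV : x \in V by rewrite !inE eqxx.
by have := disjointFr dis xV; rewrite (subsetP (partitionS Pp VP) _ xV).
Qed.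

(** The left side is the condition produced by [reindex_onto] in [interval_sum_rec], for the maps
    that add and remove [V]; its last conjunct says that [V] is not already in [P]. *)
Lemma interval_partitions_cons P :
  [&& V |: P \in interval_partitions ((x :: s1) ++ s2),
      finset.pblock (V |: P) x == V & (V |: P) :\ V == P] =
  (P \in interval_partitions s2).
Proof.
have Vi : seq_interval ((x :: s1) ++ s2) V.
  by have := seq_interval_take (size (x :: s1)) us; rewrite take_size_cat.
apply/idP/idP => [/and3P[]|].
  rewrite !inE => /andP[Pp /forall_inP Pi] _ /eqP PD.
  have Pp2 : finset.partition P [set y in s2].
    rewrite -PD; have -> : [set y in s2] = [set y in (x :: s1) ++ s2] :\: V.
      rewrite setsE setDUl setDv set0U; apply/esym/setDidPl.
      by rewrite disjoint_sym.
    by apply: partitionD1 => //; rewrite setU11.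
  rewrite Pp2; apply/forall_inP => W WP.
  rewrite -(@seq_interval_catr (x :: s1)) //; last exact: partitionS Pp2 WP.
  by apply: Pi; rewrite setU1r.
rewrite inE => /andP[Pp /forall_inP Pi].
have VP := VnP Pp.
have PU : finset.partition (V |: P) [set y in (x :: s1) ++ s2].
  by rewrite setsE; apply: partitionU1.
rewrite setU1K // eqxx andbT inE PU andTb; apply/andP; split.
  apply/forall_inP => W /setU1P[->//|WP].
  by rewrite seq_interval_catr ?Pi //; exact: partitionS Pp WP.
apply/eqP; apply: def_pblock (partition_trivIset PU) (setU11 _ _) _.
by rewrite !inE eqxx.
Qed.

(** The points of [x :: s1] come first and share the block [V], so the factor of [V] is leftmost in
    the noncommutative product. *)
Lemma seq_blocks_cons P : P \in interval_partitions s2 ->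
  seq_blocks ((x :: s1) ++ s2) (V |: P) = V :: seq_blocks s2 P.
Proof.
move=> PI; have := PI; rewrite inE => /andP[Pp _].
move: PI; rewrite -interval_partitions_cons => /and3P[].
rewrite inE => /andP[PU _] _ _.
have tU := partition_trivIset PU.
rewrite /seq_blocks map_cat.
have -> : [seq pblock (V |: P) y | y <- x :: s1] = nseq (size s1).+1 V.
  transitivity [seq V | y <- x :: s1]; last first.
    by rewrite -[(size s1).+1]/(size (x :: s1)); elim: (x :: s1) => //= y l ->.
  apply/eq_in_map => y ys; apply: def_pblock tU (setU11 _ _) _.
  by rewrite inE.
have -> : [seq pblock (V |: P) y | y <- s2] = [seq pblock P y | y <- s2].
  apply/eq_in_map => y ys; have yc : y \in cover P by rewrite (cover_partition Pp) inE.
  by apply: def_pblock tU _ _; rewrite ?mem_pblock // setU1r ?pblock_mem.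
rewrite undup_nseq_cat //; apply/mapP => -[y ys Vy]; move: (VnP Pp).
by rewrite Vy pblock_mem // (cover_partition Pp) inE.
Qed.

End FirstBlock.

Variables (R : nzRingType) (g : {set T} -> R).

Definition interval_sum s : R :=
  \sum_(P in interval_partitions s) \prod_(V <- seq_blocks s P) g V.

Lemma interval_sum_nil : interval_sum [::] = 1.
Proof.
rewrite /interval_sum (eq_bigl (pred1 set0)) ?big_pred1_eq.
  by rewrite /seq_blocks /= big_nil.
move=> P; rewrite inE /=.
have -> : [set x in [::]] = set0 :> {set T} by apply/setP => x; rewrite !inE.
rewrite partition_set0 andb_idr // => /eqP ->.
by apply/forall_inP => V; rewrite inE.
Qed.

(** An interval partition amounts to its first block, an initial segment, together with an interval
    partition of the remaining points. *)
Lemma interval_sum_rec s : uniq s -> s != [::] ->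
  interval_sum s =
    \sum_(k < size s) g [set x in take k.+1 s] * interval_sum (drop k.+1 s).
Proof.
case: s => // x s us _.
(* Partitions are sorted by the size of the first block, minus one. *)
pose h P : 'I_(size s).+1 := inord #|finset.pblock P x|.-1.
rewrite {1}/interval_sum (partition_big h xpredT) //=.
apply: eq_bigr => k _.
set V := [set y in x :: take k s].
have cV j : (j <= size s)%N -> #|[set y in x :: take j s]| = j.+1.
  move=> js; rewrite cardsE; have /card_uniqP -> : uniq (x :: take j s).
    by apply: (@subseq_uniq _ _ (x :: s)) => //=; rewrite eqxx take_subseq.
  by rewrite /= size_takel.
have ks : (k <= size s)%N by rewrite -ltnS.
have us' : uniq ((x :: take k s) ++ drop k s) by rewrite /= cat_take_drop.
(* By [first_block], the size of the first block determines it. *)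
rewrite (eq_bigl (fun P => (P \in interval_partitions (x :: s)) &&
    (finset.pblock P x == V))); last first.
  move=> P; apply: andb_id2l => PI.
  have [j js Pj] := first_block us PI.
  rewrite /h Pj cV //=; apply/eqP/eqP => [e|e].
    by rewrite /V -e inordK ?ltnS.
  by apply: val_inj; rewrite /= inordK ?ltnS //; apply: succn_inj; rewrite -cV // e cV.
rewrite (reindex_onto (fun P => V |: P) (fun P => P :\ V)) /=; last first.
  move=> P /andP[]; rewrite inE => /andP[Pp _] /eqP <-.
  rewrite setD1K // pblock_mem // (cover_partition Pp) !inE eqxx //.
rewrite big_distrr /=; apply: eq_big => P.
  by have := interval_partitions_cons us' P; rewrite /= cat_take_drop -/V andbA.
rewrite -andbA => Pc.
have PI : P \in interval_partitions (drop k s).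
  by have := interval_partitions_cons us' P; rewrite /= cat_take_drop -/V => <-.
by have := seq_blocks_cons us' PI; rewrite /= cat_take_drop -/V => ->; rewrite big_cons.
Qed.

(** One sign per block: this lets the Moebius sum of moments be written as an [interval_sum] of
    negated moments. *)
Lemma interval_sumN s : interval_sum s =
  \sum_(P in interval_partitions s)
     (-1) ^+ #|P| * \prod_(V <- seq_blocks s P) - g V.
Proof.
apply: eq_bigr => P; rewrite inE => /andP[/size_seq_blocks <- _].
elim: seq_blocks => [|V l IHl]; first by rewrite !big_nil mulr1.
rewrite !big_cons IHl /= exprSr -mulrA mulN1r mulNr opprK.
by rewrite mulrA [in RHS]mulrA commr_sign.
Qed.

End IntervalPartitions.

(** * Recursion for the bi-Boolean cumulants *)

Section CumulantRecursion.
Variables (R : nzRingType) (h : seq bool -> R).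

(** Both sums obey [interval_sum_rec], and the weights depend only on the words of colours. It is
    needed because the points left after the first block are still in ['I_(p + q)], while the
    smaller cumulant is defined on a smaller ordinal. *)
Lemma interval_sum_transport (T T' : finType) (c : T -> bool) (c' : T' -> bool)
    (g : {set T} -> R) (g' : {set T'} -> R) s s' :
  (forall l, uniq l -> g [set x in l] = h (map c l)) ->
  (forall l, uniq l -> g' [set x in l] = h (map c' l)) ->
  uniq s -> uniq s' -> map c s = map c' s' ->
  interval_sum g s = interval_sum g' s'.
Proof.
move=> hg hg'; have [n] := ubnP (size s).
elim: n s s' => // n IHn s s' sn us us' ss'.
have sz : size s = size s' by rewrite -(size_map c) ss' size_map.
have [s0|sN] := eqVneq s [::].
  by move: sz; rewrite s0 => /esym/size0nil ->; rewrite !interval_sum_nil.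
have s'N : s' != [::] by rewrite -size_eq0 -sz size_eq0.
rewrite !interval_sum_rec // -sz; apply: eq_bigr => k _; congr (_ * _).
  by rewrite hg ?take_uniq // hg' ?take_uniq // !map_take ss'.
apply: IHn; rewrite ?drop_uniq ?map_drop ?ss' // size_drop.
by rewrite ltnS in sn; apply: leq_trans sn; rewrite ltn_subrL /= lt0n size_eq0.
Qed.

End CumulantRecursion.

Section BiBooleanCumulants.
Context {K : fieldType} {B A : algType K}.
Variables (S : ncps B A) (X Y : A).

Definition bimoment (a c : nat) : B := ncps_E S (X ^+ a * Y ^+ c).

Definition neg_block (p q : nat) (V : {set 'I_(p + q)}) : B :=
  - ncps_E S (\prod_(v in V) if Defs.is_left (chi_mn v) then X else Y).

Definition left_index {p q} (v : 'I_(p + q)) : bool := Defs.is_left (chi_mn v).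

(* [signed_sum p q] is [- B_{1_chi}(X, .., X, Y, .., Y)], except that it is 1
   for [p = q = 0]. *)
Definition signed_sum (p q : nat) : B :=
  interval_sum (@neg_block p q) (chi_seq (@chi_mn p q)).

Lemma left_index_lshift p q (i : 'I_p) : left_index (lshift q i).
Proof. by rewrite /left_index /chi_mn /= ltn_ord. Qed.

Lemma left_index_rshift p q (i : 'I_q) : left_index (rshift p i) = false.
Proof. by rewrite /left_index /chi_mn /= ltnNge leq_addr. Qed.

(** Multiplying in increasing order of indices puts all left indices before all right ones, so the
    product is a power of [X] times a power of [Y], whatever the order of [l]. *)
Lemma neg_blockE p q l : uniq l -> @neg_block p q [set x in l] =
  - bimoment (count id (map left_index l)) (count negb (map left_index l)).
Proof.
move=> ul; rewrite /neg_block /bimoment; congr (- ncps_E S _).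
rewrite big_mkcond big_split_ord /=; congr (_ * _).
  rewrite (eq_bigr (fun i => if lshift q i \in l then X else 1)); last first.
    by move=> i _; rewrite inE -/(left_index _) left_index_lshift.
  rewrite -big_mkcond prodr_const; congr (_ ^+ _).
  rewrite count_map -size_filter.
  rewrite -(card_uniqP (filter_uniq _ ul)).
  rewrite -(card_imset _ (@lshift_inj p q)); apply: eq_card => v.
  rewrite mem_filter; apply/imsetP/andP => [[i il ->]|[/= + vl]].
    by rewrite /= left_index_lshift.
  rewrite -(splitK v); case: split (splitK v) => /= i e.
    by move=> _; exists i => //; rewrite unfold_in e.
  by rewrite left_index_rshift.
rewrite (eq_bigr (fun i => if rshift p i \in l then Y else 1)); last first.
  by move=> i _; rewrite inE -/(left_index _) left_index_rshift.
rewrite -big_mkcond prodr_const; congr (_ ^+ _).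
rewrite count_map -size_filter.
rewrite -(card_uniqP (filter_uniq _ ul)).
rewrite -(card_imset _ (@rshift_inj p q)); apply: eq_card => v.
rewrite mem_filter; apply/imsetP/andP => [[i il ->]|[/= + vl]].
  by rewrite /= left_index_rshift.
rewrite -(splitK v); case: split (splitK v) => /= i e.
  by rewrite left_index_lshift.
by move=> _; exists i => //; rewrite unfold_in e.
Qed.

Lemma chi_seq_uniq n (chi : 'I_n -> side) : uniq (chi_seq chi).
Proof.
have ue := enum_uniq 'I_n.
rewrite cat_uniq rev_uniq !(filter_uniq _ ue) andbT; apply/hasPn => i.
by rewrite mem_rev !mem_filter => /andP[/negPf /= ->].
Qed.

Lemma mem_chi_seq n (chi : 'I_n -> side) i : i \in chi_seq chi.
Proof.
have ie := mem_enum 'I_n i.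
rewrite mem_cat mem_rev; case e: (Defs.is_left (chi i)); apply/orP; [left|right];
  by rewrite mem_filter e ie.
Qed.

(** The right indices occur in reverse order in [chi_seq], but they all have the same colour, so the
    reversal does not show. *)
Lemma chi_seq_pattern p q :
  map left_index (chi_seq (@chi_mn p q)) = nseq p true ++ nseq q false.
Proof.
have nE (P : pred 'I_(p + q)) b : (forall v, P v -> left_index v = b) ->
    [seq left_index v | v <- enum 'I_(p + q) & P v] = nseq #|P| b.
  move=> Pb; have -> : #|P| = size [seq v <- enum 'I_(p + q) | P v].
    rewrite -(card_uniqP (filter_uniq P (enum_uniq _))).
    by apply: eq_card => v; rewrite mem_filter [v \in enum _]mem_enum andbT.
  by elim: (enum 'I_(p + q)) => //= v l IHl; case: ifP => //= /Pb ->; rewrite IHl.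
rewrite map_cat map_rev.
rewrite (nE [pred v | left_index v] true) //.
rewrite (nE [pred v | ~~ left_index v] false); last by move=> v /negPf.
have cl : #|[pred v : 'I_(p + q) | left_index v]| = p.
  rewrite -[RHS](card_ord p) -(card_codom (@lshift_inj p q)).
  apply: eq_card => v; rewrite inE; apply/idP/codomP => [|[i ->]].
    rewrite -(splitK v); case: split => /= i; first by exists i.
    by rewrite left_index_rshift.
  exact: left_index_lshift.
have cr : #|[pred v : 'I_(p + q) | ~~ left_index v]| = q.
  apply/eqP; rewrite -(eqn_add2l p) -{1}cl.
  by have := cardC [pred v : 'I_(p + q) | left_index v]; rewrite card_ord => /eqP.
by rewrite cl cr rev_nseq.
Qed.

Lemma biBoolean_mnE p q : (0 < p + q)%N ->
  biBoolean_mn S X Y p q = - signed_sum p q.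
Proof.
move=> pq; rewrite /signed_sum interval_sumN -sumrN /biBoolean_mn /biBoolean.
have setE : [set x in chi_seq (@chi_mn p q)] = [set: 'I_(p + q)].
  by apply/setP => v; rewrite !inE mem_chi_seq.
apply: eq_big => P.
  have -> : refines P BI_top.
    apply/forall_inP => V _; apply/exists_inP; exists setT; first by rewrite inE.
    exact: subsetT.
  by rewrite andbT !inE setE.
case/andP => PI _; rewrite /BI_mobius /BI_top cards1 /moment_part.
(* A partition of a nonempty set has a block; this makes the truncated exponent [#|P| - 1] exact. *)
have P0 : (0 < #|P|)%N.
  move: PI; rewrite inE => /andP[Pp _]; rewrite card_gt0.
  apply: contraTneq (Pp) => ->; rewrite /finset.partition /cover big_set0.
  rewrite eq_sym -cards_eq0 cardsT card_ord.
  by case: (p + q)%N pq.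
have -> : #|P| = (#|P|.-1).+1 by rewrite prednK.
rewrite subn1 exprS mulN1r mulNr opprK -commr_sign; congr (_ * _).
by apply: eq_bigr => V _; rewrite opprK.
Qed.

Lemma signed_sum0 : signed_sum 0 0 = 1.
Proof.
rewrite /signed_sum; have -> : chi_seq (@chi_mn 0 0) = [::].
  by apply/size0nil; rewrite -(size_map left_index) chi_seq_pattern.
exact: interval_sum_nil.
Qed.

Lemma signed_sum_rec p q : (0 < p + q)%N -> signed_sum p q =
  - (\sum_(a < p) bimoment a.+1 0 * signed_sum (p - a.+1) q
     + \sum_(c < q) bimoment p c.+1 * signed_sum 0 (q - c.+1)).
Proof.
move=> pq; rewrite /signed_sum; set s := chi_seq (@chi_mn p q).
have us : uniq s by exact: chi_seq_uniq.
have ps : map left_index s = nseq p true ++ nseq q false.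
  exact: chi_seq_pattern.
have szs : size s = (p + q)%N.
  by rewrite -(size_map left_index) ps size_cat !size_nseq.
rewrite interval_sum_rec //; last by rewrite -size_eq0 szs -lt0n.
pose h l := - bimoment (count id l) (count negb l).
(* A first block of size [k.+1] lies in the left part if [k < p]; otherwise it consists of the whole
   left part and [k.+1 - p] right points. *)
rewrite szs big_split_ord opprD -!sumrN; congr (_ + _); apply: eq_bigr => i _.
  rewrite neg_blockE ?take_uniq // map_take ps mulNr.
  have ip : (lshift q i < p)%N := ltn_ord (i : 'I_p).
  rewrite takel_cat ?size_nseq // take_nseq // !count_nseq /= mul1n mul0n.
  congr (- (_ * _)).
  apply: (interval_sum_transport (h := h)) (@neg_blockE _ _) (@neg_blockE _ _) _ _ _.
  - exact: drop_uniq.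
  - exact: chi_seq_uniq.
  rewrite chi_seq_pattern map_drop ps.
  have -> : nseq p true = nseq i.+1 true ++ nseq (p - i.+1) true.
    by rewrite -nseqD subnKC.
  by rewrite -catA drop_size_cat // size_nseq.
rewrite neg_blockE ?take_uniq // map_take ps mulNr.
rewrite take_cat size_nseq -addnS ltnNge leq_addr /= addKn take_nseq //.
rewrite !count_cat !count_nseq /= !mul1n !mul0n addn0.
congr (- (_ * _)).
apply: (interval_sum_transport (h := h)) (@neg_blockE _ _) (@neg_blockE _ _) _ _ _.
- exact: drop_uniq.
- exact: chi_seq_uniq.
rewrite chi_seq_pattern map_drop ps drop_cat size_nseq ltnNge leq_addr /=.
by rewrite addKn drop_nseq.
Qed.

End BiBooleanCumulants.

(* Imported only here: [classical_sets] reuses many names of [finset]. *)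
From mathcomp Require Import finmap complex ring zify.
From mathcomp Require Import boolp classical_sets reals topology normedtype.

Import Order.TTheory Num.Theory.
Import numFieldNormedType.Exports.
Local Open Scope classical_set_scope.
Local Open Scope ring_scope.

(** * Absolutely summable families *)

#[local] Existing Instance summability.totally_filter.

Section BoundedSums.
Variable K : numFieldType.

(** Duplicate-free sequences stand for finite sets, so that [iota] and lists of pairs can be used
    directly. *)
Definition bounded_sums (I : choiceType) (u : I -> K) : Prop :=
  exists M : K, forall s : seq I, uniq s -> \sum_(i <- s) u i <= M.

Lemma partial_sumE (I : choiceType) (V : zmodType) (x : I -> V) (J : {fset I}) :
  summability.partial_sum x J = \sum_(i <- J) x i.
Proof. by rewrite /summability.partial_sum big_seq_fsetE. Qed.

Lemma abs_summableP (I : choiceType) (V : normedModType K) (x : I -> V) :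
  abs_summable x <-> bounded_sums (fun i => `|x i|).
Proof.
split=> -[M hM]; exists M.
  move=> s us; have := hM [fset i in s]%fset; rewrite partial_sumE.
  congr (_ <= _); apply: perm_big; apply: uniq_perm => // i.
  by rewrite in_fset.
by move=> J; rewrite partial_sumE; apply: hM.
Qed.

Lemma ler_sum_subset (I : eqType) (u : I -> K) (s t : seq I) :
  (forall i, 0 <= u i) -> uniq s -> {subset s <= t} ->
  \sum_(i <- s) u i <= \sum_(i <- t) u i.
Proof.
move=> u0 us st; have [t' ->] : exists t', \sum_(i <- t) u i =
    \sum_(i <- s) u i + \sum_(i <- t') u i.
  elim: s t us st => [|i s IHs] t /=; first by exists t; rewrite big_nil add0r.
  case/andP=> si us st; have it : i \in t by apply: st; rewrite mem_head.
  have [|t' e] := IHs (rem i t) us.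
    move=> j js; have := st j; rewrite inE js orbT => /(_ isT).
    rewrite (perm_mem (perm_to_rem it)) inE; case: eqP => // ji.
    by rewrite -ji js in si.
  by exists t'; rewrite (perm_big _ (perm_to_rem it)) !big_cons e /= addrA.
by rewrite lerDl sumr_ge0.
Qed.

Lemma bounded_sums_abs_summable (I : choiceType) (V : normedModType K)
    (x : I -> V) (u : I -> K) :
  (forall i, `|x i| <= u i) -> bounded_sums u -> abs_summable x.
Proof.
move=> xu [M hM]; apply/abs_summableP; exists M => s /hM; apply: le_trans.
by apply: ler_sum.
Qed.

Lemma abs_summable_comp (I J : choiceType) (V : normedModType K) (x : I -> V)
    (h : J -> I) : injective h -> abs_summable x -> abs_summable (x \o h).
Proof.
move=> hI /abs_summableP[M hM]; apply/abs_summableP; exists M => s us.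
by have := hM (map h s); rewrite big_map; apply; rewrite map_inj_uniq.
Qed.

Lemma bounded_sumsZ (I : choiceType) (u : I -> K) (k : K) :
  0 <= k -> bounded_sums u -> bounded_sums (fun i => k * u i).
Proof.
move=> k0 [M hM]; exists (k * M) => s us.
by rewrite -mulr_sumr ler_wpM2l ?hM.
Qed.

Lemma bounded_sumsM (I J : choiceType) (u : I -> K) (v : J -> K) :
  (forall i, 0 <= u i) -> (forall j, 0 <= v j) ->
  bounded_sums u -> bounded_sums v ->
  bounded_sums (fun p : I * J => u p.1 * v p.2).
Proof.
move=> u0 v0 [M hM] [N hN]; exists (M * N) => s us.
(* The finite set [s] of pairs is enclosed in the rectangle of its projections. *)
pose s1 := undup (map fst s); pose s2 := undup (map snd s).
apply: (@le_trans _ _ (\sum_(p <- [seq (i, j) | i <- s1, j <- s2]) u p.1 * v p.2)).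
  apply: ler_sum_subset => // [p|[i j] ijs]; first by rewrite mulr_ge0.
  by apply/allpairsP; exists (i, j); rewrite !mem_undup !map_f.
rewrite big_allpairs_dep /=.
under eq_bigr do rewrite -mulr_sumr.
rewrite -mulr_suml ler_pM ?sumr_ge0 ?hM ?hN ?undup_uniq //.
Qed.

Lemma bounded_sums_geometric (t : K) : 0 <= t -> t < 1 ->
  bounded_sums (fun n => t ^+ n).
Proof.
move=> t0 t1; exists (1 - t)^-1 => s us.
have t1' : 0 < 1 - t by rewrite subr_gt0.
(* The exponents are enclosed in an initial segment, where the geometric sum telescopes after
   multiplication by [1 - t]. *)
apply: (@le_trans _ _ (\sum_(i <- iota 0 (\max_(i <- s) i).+1) t ^+ i)).
  apply: ler_sum_subset => // [i|i si]; first by rewrite exprn_ge0.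
  by rewrite mem_iota ltnS leq_bigmax_seq.
rewrite -[(1 - t)^-1]mul1r ler_pdivlMr // mulrC.
rewrite -[X in iota 0 X]subn0 -/(index_iota 0 _) big_mkord.
by rewrite -opprB mulNr -subrX1 opprB gerBl exprn_ge0.
Qed.

End BoundedSums.

(** * Unconditional sums in a Banach space *)

Section FamilySums.
Variables (R : realType) (V : completeNormedModType R[i]).

Lemma sum_fset_split (W : zmodType) (I : choiceType) (x : I -> W) (J0 J : {fset I}) :
  (J0 `<=` J)%fset -> \sum_(i <- J) x i =
    \sum_(i <- J0) x i + \sum_(i <- (J `\` J0)%fset) x i.
Proof.
move=> J0J; rewrite (bigID (mem J0)) /=; congr (_ + _); rewrite -big_filter;
  apply: perm_big; apply: uniq_perm; rewrite ?filter_uniq // => i;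
  rewrite mem_filter.
  by rewrite andb_idr // => /(fsubsetP J0J).
by rewrite in_fsetD.
Qed.

(** The net of partial sums is Cauchy: once the sum of norms over [J0] is within [e] of its
    supremum, enlarging [J0] changes the partial sum by less than [e]. *)
Lemma abs_summable_cvg (I : choiceType) (x : I -> V) : abs_summable x ->
  summability.partial_sum x @ summability.totally --> family_sum x.
Proof.
move=> [M hM]; apply/cauchy_cvgP/cauchy_exP => e e0.
pose N J : R[i] := summability.partial_sum (fun i => `|x i|) J.
have N0 J : 0 <= N J by apply: sumr_ge0.
have M0 : 0 <= M := le_trans (N0 fset0) (hM fset0).
(* The supremum is taken in [R]; sums of norms are nonnegative in [R[i]], hence equal to their real
   parts. *)
pose A := [set complex.Re (N J) | J in [set: {fset I}]].
have ReE (z : R[i]) : 0 <= z -> z = (complex.Re z)%:C%C.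
  by case: z => a b; rewrite lecE /= => /andP[/eqP -> _].
have supA : has_sup A.
  split; first by exists (complex.Re (N fset0)); exists fset0.
  exists (complex.Re M) => _ [J _ <-].
  by move: (hM J); rewrite -/(N J) (ReE _ (N0 J)) (ReE _ M0) lecR.
have e0' : 0 < complex.Re e.
  by have := e0; rewrite (ReE _ (ltW e0)) ltcR.
have [_ [J0 _ <-] hJ0] := sup_adherent e0' supA.
exists (summability.partial_sum x J0); exists J0 => // J /= J0J.
rewrite -ball_normE /= distrC !partial_sumE (sum_fset_split x J0J) addrC addKr.
apply: le_lt_trans (ler_norm_sum _ _ _) _.
have -> : \sum_(i <- (J `\` J0)%fset) `|x i| = N J - N J0.
  by rewrite /N !partial_sumE (sum_fset_split _ J0J) addrC addKr.
rewrite (ReE _ (N0 J)) (ReE _ (N0 J0)) (ReE _ (ltW e0)) -rmorphB ltcR.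
have hJ : complex.Re (N J) <= sup A by apply: sup_ubound; [case: supA|exists J].
by rewrite ltrBlDr; apply: le_lt_trans hJ _; rewrite -ltrBlDl.
Qed.

Definition exhausts (I : choiceType) (E : nat -> seq I) : Prop :=
  (forall n, uniq (E n)) /\ forall i, \forall n \near \oo, i \in E n.

(** Every finite set is eventually contained in [E n], so the limit along finite subsets can be read
    off a sequence. *)
Lemma family_sum_exhaust (I : choiceType) (x : I -> V) (E : nat -> seq I) :
  abs_summable x -> exhausts E ->
  (fun n => \sum_(i <- E n) x i) @ \oo --> family_sum x.
Proof.
move=> /abs_summable_cvg xs [Eu Ein].
have -> : (fun n => \sum_(i <- E n) x i) =
    summability.partial_sum x \o (fun n => [fset i in E n]%fset).
  apply/funext => n /=; rewrite partial_sumE; apply: perm_big.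
  by apply: uniq_perm => // i; rewrite in_fset.
apply: cvg_comp xs => P [J _ JP].
suff : \forall n \near \oo, {subset J <= E n}.
  apply: filterS => n Jn; apply: JP => /=; apply/fsubsetP => i /Jn.
  by rewrite in_fset.
have : forall s : seq I, \forall n \near \oo, {subset s <= E n}.
  elim=> [|i s IHs]; first exact: nearW.
  apply: filterS2 (Ein i) IHs => n iE sE j; rewrite inE => /predU1P[->//|].
  exact: sE.
exact.
Qed.

(** Rearrangement by the finite fibres [L g] of [phi]: the concatenated fibres over [E n] exhaust
    [I]. *)
Lemma family_sum_fibers (I G : choiceType) (x : I -> V) (phi : I -> G)
    (L : G -> seq I) (E : nat -> seq G) :
  abs_summable x -> exhausts E -> (forall g, uniq (L g)) ->
  (forall g i, (i \in L g) = (phi i == g)) ->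
  (fun n => \sum_(g <- E n) \sum_(i <- L g) x i) @ \oo --> family_sum x.
Proof.
move=> xs [Eu Ein] Lu LP.
have := @family_sum_exhaust I x (fun n => [seq i | g <- E n, i <- L g]) xs.
have -> : (fun n => \sum_(i <- [seq i | g <- E n, i <- L g]) x i) =
  (fun n => \sum_(g <- E n) \sum_(i <- L g) x i).
  by apply/funext => n; rewrite big_allpairs_dep.
apply; split=> [n|i].
  apply: allpairs_uniq_dep => // u v /allpairsPdep[g [i [_ ig ->]]].
  move=> /allpairsPdep[g' [i' [_ ig' ->]]] /= e.
  move: ig ig'; rewrite !LP e => /eqP <- /eqP <-.
  by [].
apply: filterS (Ein (phi i)) => n iE.
by apply/allpairsPdep; exists (phi i), i; rewrite LP.
Qed.

Lemma exhausts_iota : exhausts (iota 0).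
Proof.
split=> [n|i]; first exact: iota_uniq.
by exists i.+1 => // n /= ni; rewrite mem_iota.
Qed.

Lemma exhausts_iotaS : exhausts (fun n => iota 0 n.+1).
Proof.
split=> [n|i]; first exact: iota_uniq.
by exists i => // n /= ni; rewrite (mem_iota 0 n.+1).
Qed.

Lemma exhausts_allpairs (I J : choiceType) (E : nat -> seq I) (F : nat -> seq J) :
  exhausts E -> exhausts F ->
  exhausts (fun n => [seq (i, j) | i <- E n, j <- F n]).
Proof.
move=> [Eu Ei] [Fu Fi]; split=> [n|[i j]].
  by apply: allpairs_uniq => // -[? ?] [? ?].
near=> n; apply/allpairsP; exists (i, j); split=> //=; near: n.
  exact: Ei.
exact: Fi.
Unshelve. all: by end_near. Qed.

Lemma family_sum_nat_recl (x : nat -> V) : abs_summable x ->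
  family_sum x = x 0%N + family_sum (fun n => x n.+1).
Proof.
move=> xs; have xs' : abs_summable (fun n => x n.+1).
  exact: (abs_summable_comp succn_inj xs).
have h1 := family_sum_exhaust xs exhausts_iotaS.
rewrite -[LHS](cvg_lim (@norm_hausdorff _ V) h1).
apply: (cvg_lim (@norm_hausdorff _ V)).
apply: cvg_trans (cvgD (cvg_cst (x 0%N)) (family_sum_exhaust xs' exhausts_iota)).
apply: near_eq_cvg; near=> n.
by rewrite /= big_cons -[1%N]/(1 + 0)%N iotaDl big_map.
Unshelve. all: by end_near. Qed.

Lemma family_sum_rem (I : choiceType) (x : I -> V) (i0 : I) : abs_summable x ->
  family_sum (fun i => if i == i0 then 0 else x i) = family_sum x - x i0.
Proof.
move=> /abs_summable_cvg xs; apply: (cvg_lim (@norm_hausdorff _ V)).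
apply: cvg_trans (cvgB xs (cvg_cst (x i0))).
(* The two partial sums agree as soon as the finite set contains [i0]. *)
apply: near_eq_cvg; exists [fset i0]%fset => // J.
rewrite /= fsub1set => iJ; rewrite /GRing.add /= /GRing.opp /= !partial_sumE.
rewrite !(big_fsetD1 i0 iJ) /= eqxx add0r addrC addKr.
rewrite !big_seq; apply: eq_bigr => i; rewrite in_fsetD1 => /andP[/negPf -> _].
by [].
Qed.

Lemma family_sumN (I : choiceType) (x : I -> V) : abs_summable x ->
  family_sum (fun i => - x i) = - family_sum x.
Proof.
move=> /abs_summable_cvg xs; apply: (cvg_lim (@norm_hausdorff _ V)).
apply: cvg_trans (cvgN xs); apply: near_eq_cvg; apply: nearW => J /=.
by rewrite /GRing.opp /= !partial_sumE sumrN.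
Qed.

End FamilySums.

Lemma sum_delta (R : pzSemiRingType) (I : eqType) (s : seq I) (i0 : I) :
  uniq s -> i0 \in s -> \sum_(i <- s) (i == i0)%:R = 1 :> R.
Proof.
move=> us i0s; rewrite (bigD1_seq i0) //= eqxx big1 ?addr0 // => i /negPf ->.
by [].
Qed.

(** * Products of sums in a Banach algebra *)

Section BanachAlgebraSums.
Variables (R : realType) (A : banachAlgType R[i]).

Lemma banach_normM (x y : A) : `|x * y| <= `|x| * `|y|.
Proof. exact: banach_norm_mul. Qed.

Lemma banach_cvgM (T : Type) (F : set_system T) {FF : Filter F} (u v : T -> A)
    (a b : A) :
  u @ F --> a -> v @ F --> b -> (fun t => u t * v t) @ F --> a * b.
Proof.
move=> ua vb; apply/cvgrPdist_lt => e e0.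
have b0 : 0 < `|b| + 1 by rewrite ltr_wpDl.
have a0 : 0 < `|a| + 1 by rewrite ltr_wpDl.
(* Each half of [e] pays for one factor: [|b| + 1] eventually bounds [v], and [|a| + 1] is a
   positive bound for [a]. *)
have h1 := @cvgr_dist_lt _ _ _ F FF u a ua _ (divr_gt0 (divr_gt0 e0 (ltr0Sn _ 1)) b0).
have h2 := @cvgr_dist_lt _ _ _ F FF v b vb _ (divr_gt0 (divr_gt0 e0 (ltr0Sn _ 1)) a0).
have h3 := @cvgr_dist_lt _ _ _ F FF v b vb _ ltr01.
apply: filterS3 h1 h2 h3 => t t1 t2 t3.
have -> : a * b - u t * v t = (a - u t) * v t + a * (b - v t).
  by rewrite mulrBl mulrBr [RHS]addrC addrA subrK.
apply: le_lt_trans (ler_normD _ _) _.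
have vt : `|v t| <= `|b| + 1.
  rewrite -[v t](subKr b); apply: le_trans (ler_normB _ _) _.
  by rewrite lerD2l ltW.
rewrite [e]splitr; apply: ltr_leD.
  apply: le_lt_trans (banach_normM _ _) _.
  apply: (@le_lt_trans _ _ (`|a - u t| * (`|b| + 1))); first by rewrite ler_wpM2l.
  by rewrite -ltr_pdivlMr.
apply: le_trans (banach_normM _ _) _.
apply: (@le_trans _ _ ((`|a| + 1) * `|b - v t|)).
  by rewrite ler_wpM2r // lerDl.
by rewrite mulrC -ler_pdivlMr // ltW.
Qed.

Lemma abs_summableM (I J : choiceType) (x : I -> A) (y : J -> A) :
  abs_summable x -> abs_summable y ->
  abs_summable (fun p : I * J => x p.1 * y p.2).
Proof.
move=> /abs_summableP xs /abs_summableP ys.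
apply: bounded_sums_abs_summable (bounded_sumsM _ _ xs ys) => // p.
exact: banach_normM.
Qed.

(** Over the rectangles built from [E n] and [F n], the partial sums of the double family factor. *)
Lemma family_sumM (I J : choiceType) (x : I -> A) (y : J -> A)
    (E : nat -> seq I) (F : nat -> seq J) :
  abs_summable x -> abs_summable y -> exhausts E -> exhausts F ->
  family_sum (fun p : I * J => x p.1 * y p.2) = family_sum x * family_sum y.
Proof.
move=> xs ys hE hF.
have xys := family_sum_exhaust (abs_summableM xs ys) (exhausts_allpairs hE hF).
rewrite -[LHS](cvg_lim (@norm_hausdorff _ A) xys).
apply: (cvg_lim (@norm_hausdorff _ A)).
apply: cvg_trans (banach_cvgM (family_sum_exhaust xs hE) (family_sum_exhaust ys hF)).
apply: near_eq_cvg; apply: nearW => n /=.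
rewrite big_allpairs_dep /= big_distrl /=.
by apply: eq_bigr => i _; rewrite big_distrr.
Qed.

(** The Cauchy product is regrouped along antidiagonals, of which only the one at 0 contributes. The
    lists [iota 0 n.+1] always contain 0, so every partial sum is already 1. *)
Lemma family_sum_convolution (x y : nat -> A) :
  abs_summable x -> abs_summable y ->
  (forall n, \sum_(a < n.+1) x a * y (n - a)%N = (n == 0%N)%:R) ->
  family_sum x * family_sum y = 1.
Proof.
move=> xs ys xy; rewrite -(family_sumM xs ys exhausts_iota exhausts_iota).
have h := @family_sum_fibers _ A _ _ _ (fun p => p.1 + p.2)%N
  (fun k => [seq (a, (k - a)%N) | a <- iota 0 k.+1]) _ (abs_summableM xs ys)
  exhausts_iotaS.
rewrite -(cvg_lim (@norm_hausdorff _ A) (h _ _)).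
- apply: (cvg_lim (@norm_hausdorff _ A)).
  rewrite (_ : (fun n => _) = fun=> 1); first exact: cvg_cst.
  apply/funext => n; rewrite -[RHS](sum_delta A (iota_uniq 0 n.+1) (mem_head 0%N _)).
  apply: eq_bigr => k _.
  by rewrite big_map -[iota 0 k.+1]/(index_iota 0 k.+1) big_mkord xy.
- move=> k; rewrite map_inj_uniq ?iota_uniq // => a b []//.
- move=> k [a b]; apply/mapP/eqP => [[c ck [-> ->]]|<-].
    by move: ck; rewrite mem_iota ltnS => /andP[_ /subnKC].
  exists a; last by rewrite /= addKn.
  by rewrite mem_iota /= add0n ltnS leq_addr.
Qed.


(* With generating functions [m], [f], [g], [w], the hypothesis [hconv] says
   that [m * f + g * w = 1], where [g] is shifted by one in its second index. *)
Lemma family_sum_convolution2 (m w : nat -> A) (f g : nat * nat -> A) :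
  abs_summable m -> abs_summable w -> abs_summable f -> abs_summable g ->
  (forall p q, \sum_(a < p.+1) m a * f ((p - a)%N, q)
     + \sum_(c < q) g (p, c : nat) * w (q - c.+1)%N = ((p, q) == (0%N, 0%N))%:R) ->
  family_sum m * family_sum f + family_sum g * family_sum w = 1.
Proof.
move=> ms ws fs gs hconv.
pose E n := [seq (p, q) | p <- iota 0 n.+1, q <- iota 0 n.+1].
have hE : exhausts E by exact: exhausts_allpairs exhausts_iotaS exhausts_iotaS.
rewrite -(family_sumM ms fs exhausts_iota hE) -(family_sumM gs ws hE exhausts_iota).
have h1 : \sum_(u <- E n) \sum_(a < u.1.+1) m a * f ((u.1 - a)%N, u.2)
    @[n --> \oo] --> family_sum (fun t : nat * (nat * nat) => m t.1 * f t.2).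
  (* The product [m a * f (b, c)] contributes to the index [(a + b, c)]. *)
  pose phi (t : nat * (nat * nat)) := (t.1 + t.2.1, t.2.2)%N.
  pose L (u : nat * nat) := [seq (a, ((u.1 - a)%N, u.2)) | a <- iota 0 u.1.+1].
  have LE u : \sum_(a < u.1.+1) m a * f ((u.1 - a)%N, u.2) =
      \sum_(t <- L u) m t.1 * f t.2.
    by rewrite big_map -[iota 0 u.1.+1]/(index_iota 0 u.1.+1) big_mkord.
  under eq_fun do under eq_bigr do rewrite LE.
  apply: (@family_sum_fibers _ A _ _ _ phi L _ (abs_summableM ms fs) hE).
    by move=> u; rewrite map_inj_uniq ?iota_uniq // => a b [].
  move=> [p q] [a [b c]]; apply/mapP/eqP => [[a' ap [-> -> ->]]|[<- <-]].
    by move: ap; rewrite mem_iota /= add0n ltnS /phi /= => /subnKC ->.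
  exists a; last by rewrite /= addKn.
  by rewrite mem_iota /= add0n ltnS leq_addr.
have h2 : \sum_(u <- E n) \sum_(c < u.2) g (u.1, c : nat) * w (u.2 - c.+1)%N
    @[n --> \oo] --> family_sum (fun t : (nat * nat) * nat => g t.1 * w t.2).
  (* Because of the shift in [g], the product [g (a, b) * w c] contributes to the index
     [(a, b + c + 1)]. *)
  pose phi (t : (nat * nat) * nat) := (t.1.1, t.1.2 + t.2.+1)%N.
  pose L (u : nat * nat) := [seq ((u.1, c), (u.2 - c.+1)%N) | c <- iota 0 u.2].
  have LE u : \sum_(c < u.2) g (u.1, c : nat) * w (u.2 - c.+1)%N =
      \sum_(t <- L u) g t.1 * w t.2.
    by rewrite big_map -[X in iota 0 X]subn0 -/(index_iota 0 u.2) big_mkord.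
  under eq_fun do under eq_bigr do rewrite LE.
  apply: (@family_sum_fibers _ A _ _ _ phi L _ (abs_summableM gs ws) hE).
    by move=> u; rewrite map_inj_uniq ?iota_uniq // => a b [].
  move=> [p q] [[a b] c]; apply/mapP/eqP => [[b' bq [-> -> ->]]|[<- <-]].
    by move: bq; rewrite mem_iota /= add0n /phi /= addnS -addSn => /subnKC ->.
  exists b; last by rewrite /= addnS -addSn addKn.
  by rewrite mem_iota /= add0n addnS ltnS leq_addr.
rewrite -[LHS](cvg_lim (@norm_hausdorff _ A) (cvgD h1 h2)).
apply: (cvg_lim (@norm_hausdorff _ A)).
apply: cvg_trans (@cvg_cst A 1 nat \oo _); apply: near_eq_cvg; apply: nearW => n.
rewrite [RHS]/GRing.add /= -big_split /=.
rewrite -[LHS](sum_delta A (hE.1 n) (_ : (0%N, 0%N) \in E n)).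
  by apply: eq_bigr => -[p q] _; rewrite hconv.
by apply/allpairsP; exists (0%N, 0%N).
Qed.

End BanachAlgebraSums.

(** * Geometric bounds and the identity of the transforms *)

(** A right inverse of a power series with constant term 1 is also a left inverse, even over a
    noncommutative ring. With truncations [p] and [q], the product [q * p * q] agrees with [q] up to
    degree [n], and [q] is then cancelled degree by degree. *)
Lemma convolution_inverse (R : nzRingType) (x y : nat -> R) :
  x 0%N = 1 -> y 0%N = 1 ->
  (forall n, \sum_(a < n.+1) x a * y (n - a)%N = (n == 0%N)%:R) ->
  forall n, \sum_(a < n.+1) y a * x (n - a)%N = (n == 0%N)%:R.
Proof.
move=> x0 y0 xy n.
pose p := \poly_(i < n.+1) x i; pose q := \poly_(i < n.+1) y i.
have coefpq (u v : nat -> R) i : (i <= n)%N ->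
    (\poly_(i < n.+1) u i * \poly_(i < n.+1) v i)`_i =
    \sum_(a < i.+1) u a * v (i - a)%N.
  move=> ile; rewrite coefM; apply: eq_bigr => -[a /= ai] _.
  rewrite !coef_poly !ltnS (leq_trans _ ile) // (leq_trans _ ile) //.
  by rewrite leq_subr.
have qpq i : (i <= n)%N -> (q * p * q)`_i = y i.
  move=> ile; rewrite -mulrA coefM big_ord_recr /= subnn.
  rewrite coefpq // xy eqxx mulr1 coef_poly ltnS ile big1 ?add0r // => -[a /= ai] _.
  rewrite coefpq ?xy ?(leq_trans (leq_subr _ _)) //.
  by rewrite subn_eq0 leqNgt ai mulr0.
suff h i : (i <= n)%N -> (q * p)`_i = (i == 0%N)%:R by rewrite -coefpq // h.
elim/ltn_ind: i => i IHi ile.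
have := qpq i ile; rewrite coefM big_ord_recr /= subnn [q`_0]coef_poly y0 mulr1.
case: i IHi ile => [|i] IHi ile; first by rewrite big_ord0 add0r y0.
rewrite big_ord_recl big1 /=.
  rewrite IHi // eqxx mul1r subn0 coef_poly ltnS ile addr0.
  by move/(canRL (addKr _)); rewrite addNr.
move=> [a ai] _; rewrite [bump _ _]add1n.
by rewrite IHi ?mul0r // (leq_trans _ ile) // ltnW.
Qed.

Lemma bounded_map_ge0 (K : numFieldType) (V W : normedModType K) (f : V -> W) :
  bounded_map f -> exists2 M : K, 0 <= M & forall x, `|f x| <= M * `|x|.
Proof.
move=> [M hM]; exists `|M| => // x; apply: le_trans (hM x) _.
(* Since [M * |x|] bounds a norm it is nonnegative, hence equal to [|M| * |x|]. *)
have := le_trans (normr_ge0 _) (hM x).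
by move=> /ger0_norm <-; rewrite normrM normr_id.
Qed.

Section Transforms.
Variables (R : realType) (B A : banachAlgType R[i]).

Lemma family_sum_inverse (x y : nat -> B) :
  abs_summable x -> abs_summable y -> x 0%N = 1 -> y 0%N = 1 ->
  (forall n, \sum_(a < n.+1) x a * y (n - a)%N = (n == 0%N)%:R) ->
  family_sum x \is a GRing.unit /\ (family_sum x)^-1 = family_sum y.
Proof.
move=> xs ys x0 y0 xy.
have xy1 := family_sum_convolution xs ys xy.
have yx1 := family_sum_convolution ys xs (convolution_inverse x0 y0 xy).
have xu : family_sum x \is a GRing.unit by apply/unitrP; exists (family_sum y).
by split=> //; rewrite -[RHS](mulKr xu) xy1 mulr1.
Qed.

(** Applied to the moments, this isolates the pure left ones, so that the remaining sum is
    [M - M^l]. *)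
Lemma family_sum_split0 (x : nat * nat -> B) :
  abs_summable x -> family_sum x =
    family_sum (fun p => x (p, 0%N)) + family_sum (fun u => x (u.1, u.2.+1)).
Proof.
move=> xs.
have x0s : abs_summable (fun p => x (p, 0%N)).
  by apply: (abs_summable_comp _ xs) => p q [].
have x1s : abs_summable (fun u => x (u.1, u.2.+1)).
  by apply: (@abs_summable_comp _ _ _ _ _ (fun u => (u.1, u.2.+1)) _ xs) => -[? ?] [? ?] [-> ->].
(* The second coordinate gets one index more, so that a square is left after removing 0 and
   shifting. *)
have E n : \sum_(u <- [seq (i, j) | i <- iota 0 n, j <- iota 0 n.+1]) x u =
    \sum_(i <- iota 0 n) x (i, 0%N) +
    \sum_(u <- [seq (i, j) | i <- iota 0 n, j <- iota 0 n]) x (u.1, u.2.+1).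
  have -> : iota 0 n.+1 = 0%N :: map succn (iota 0 n) by rewrite -(iotaDl 1 0 n).
  rewrite !big_allpairs_dep -big_split; apply: eq_bigr => p _.
  by rewrite big_cons big_map.
have h := family_sum_exhaust xs
  (exhausts_allpairs exhausts_iota exhausts_iotaS).
rewrite -[LHS](cvg_lim (@norm_hausdorff _ B) h).
apply: (cvg_lim (@norm_hausdorff _ B)).
apply: cvg_trans (cvgD (family_sum_exhaust x0s exhausts_iota)
  (family_sum_exhaust x1s (exhausts_allpairs exhausts_iota exhausts_iota))).
by apply: near_eq_cvg; apply: nearW => n; rewrite E.
Qed.

Variable S : ncps B A.

(** The factor [|1|] accounts for the power 0, as the unit need not have norm 1. *)
Lemma banach_normX (x : A) (t : R[i]) n : `|x| <= t -> `|x ^+ n| <= `|1 : A| * t ^+ n.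
Proof.
move=> xt; elim: n => [|n IHn]; first by rewrite !expr0 mulr1.
rewrite !exprSr mulrA; apply: le_trans (banach_normM _ _) _.
by rewrite ler_pM.
Qed.

Lemma bimoment_bound (M t : R[i]) (X Y : A) :
  (forall z, `|ncps_E S z| <= M * `|z|) -> 0 <= M ->
  `|X| <= t -> `|Y| <= t ->
  forall a c, `|bimoment S X Y a c| <= M * (`|1 : A| * `|1 : A|) * t ^+ (a + c).
Proof.
move=> hM M0 Xt Yt a c; apply: le_trans (hM _) _.
rewrite -mulrA ler_wpM2l // exprD mulrACA.
apply: le_trans (banach_normM _ _) _.
by rewrite ler_pM // banach_normX.
Qed.

(** Strong induction on [p + q]: each of the two sums in [signed_sum_rec] is at most half of the
    claimed bound. *)
Lemma signed_sum_bound (C t s x : R[i]) (X Y : A) :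
  0 <= C -> 0 <= t -> 0 <= s -> 0 <= x -> x < 1 -> 2 * C * x <= 1 - x -> t <= s * x ->
  (forall a c, `|bimoment S X Y a c| <= C * t ^+ (a + c)) ->
  forall p q, `|signed_sum S X Y p q| <= `|1 : B| * s ^+ (p + q).
Proof.
move=> C0 t0 s0 x0 x1 Cx tsx hC p q.
have [n] := ubnP (p + q)%N; elim: n p q => // n IHn p q; rewrite ltnS => pqn.
have [pq0|pq0] := posnP (p + q)%N.
  have [-> ->] : p = 0%N /\ q = 0%N by case: p q pq0 {pqn} => [|?] [|?].
  by rewrite signed_sum0 mulr1.
have x1' : 0 < 1 - x by rewrite subr_gt0.
(* This is where [2 * C * x <= 1 - x] enters: [1 - x] times the geometric sum is at most 1. *)
have geo k : 2 * C * \sum_(i < k) x ^+ i.+1 <= 1.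
  rewrite (eq_bigr (fun i : 'I_k => x * x ^+ i)) => [|i _]; last by rewrite exprS.
  rewrite -big_distrr mulrA; apply: (@le_trans _ _ ((1 - x) * \sum_(i < k) x ^+ i)).
    by rewrite ler_wpM2r // sumr_ge0 // => i _; rewrite exprn_ge0.
  by rewrite -opprB mulNr -subrX1 opprB gerBl exprn_ge0.
have geo2 k : C * \sum_(i < k) x ^+ i.+1 <= 2^-1.
  by rewrite -[2^-1]mul1r ler_pdivlMr // mulrC mulrA.
(* By [t <= s * x], the power [t ^+ k] yields [s ^+ k], kept for the bound, and [x ^+ k], summed
   over the blocks. *)
have step k j (u v : B) : `|u| <= C * t ^+ k -> `|v| <= `|1 : B| * s ^+ j ->
    `|u * v| <= `|1 : B| * s ^+ (k + j) * (C * x ^+ k).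
  move=> uk vj; apply: le_trans (banach_normM _ _) _.
  have -> : `|1 : B| * s ^+ (k + j) * (C * x ^+ k) =
      C * (s * x) ^+ k * (`|1 : B| * s ^+ j) by rewrite exprD exprMn; ring.
  apply: ler_pM => //; apply: le_trans uk _; rewrite ler_wpM2l // lerXn2r //.
  by rewrite nnegrE mulr_ge0.
pose D := `|1 : B| * s ^+ (p + q).
have D0 : 0 <= D by rewrite mulr_ge0 ?exprn_ge0.
have total k (u : 'I_k -> B) : (forall i, `|u i| <= D * (C * x ^+ i.+1)) ->
    `|\sum_(i < k) u i| <= D * 2^-1.
  move=> hu; apply: le_trans (ler_norm_sum _ _ _) _.
  apply: (@le_trans _ _ (D * (C * \sum_(i < k) x ^+ i.+1))).
    by rewrite !big_distrr; apply: ler_sum.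
  by rewrite ler_wpM2l.
rewrite signed_sum_rec // normrN; apply: le_trans (ler_normD _ _) _.
rewrite -/D [D in X in _ <= X]splitr; apply: lerD; apply: total => i.
  have -> : D = `|1 : B| * s ^+ (i.+1 + (p - i.+1 + q)) by rewrite addnA subnKC.
  apply: step; first by have := hC i.+1 0%N; rewrite addn0.
  by apply: IHn; have := ltn_ord i; lia.
have /step h : `|bimoment S X Y p i.+1| <= C * t ^+ (p + i.+1) by [].
have /h : `|signed_sum S X Y 0 (q - i.+1)| <= `|1 : B| * s ^+ (q - i.+1).
  by apply: IHn; have := ltn_ord i; lia.
rewrite -addnA subnKC // => /le_trans; apply; rewrite ler_wpM2l // ler_wpM2l //.
(* A block containing the whole left part gives [x ^+ (p + i.+1)]; the extra factor [x ^+ p] is at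
   most 1. *)
by rewrite exprD ler_piMl ?exprn_ge0 // exprn_ile1 // ltW.
Qed.

End Transforms.

(** * Convolution identities and the formula for small arguments *)

Section SmallArguments.
Variables (R : realType) (B A : banachAlgType R[i]) (S : ncps B A).

Lemma bimoment00 (X Y : A) : bimoment S X Y 0 0 = 1.
Proof. by rewrite /bimoment !expr0 mulr1 ncps_E1. Qed.

Lemma signed_sum_left_convolution (X Y : A) n :
  \sum_(a < n.+1) bimoment S X Y a 0 * signed_sum S X Y (n - a) 0 = (n == 0%N)%:R.
Proof.
rewrite big_ord_recl bimoment00 mul1r subn0.
case: n => [|n]; first by rewrite big_ord0 addr0 signed_sum0.
by rewrite signed_sum_rec // big_ord0 addr0 addNr.
Qed.

Lemma signed_sum_right_convolution (X Y : A) n :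
  \sum_(a < n.+1) bimoment S X Y 0 a * signed_sum S X Y 0 (n - a) = (n == 0%N)%:R.
Proof.
rewrite big_ord_recl bimoment00 mul1r subn0.
case: n => [|n]; first by rewrite big_ord0 addr0 signed_sum0.
by rewrite signed_sum_rec // big_ord0 add0r addNr.
Qed.

Lemma signed_sum_convolution (X Y : A) p q :
  \sum_(a < p.+1) bimoment S X Y a 0 * signed_sum S X Y (p - a) q
    + \sum_(c < q) bimoment S X Y p c.+1 * signed_sum S X Y 0 (q - c.+1)
  = ((p, q) == (0%N, 0%N))%:R.
Proof.
rewrite big_ord_recl bimoment00 mul1r subn0.
have [pq0|pq] := posnP (p + q)%N.
  have [-> ->] : p = 0%N /\ q = 0%N by lia.
  by rewrite !big_ord0 !addr0 signed_sum0.
have -> : ((p, q) == (0%N, 0%N)) = false by rewrite xpair_eqE; lia.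
by rewrite signed_sum_rec // -addrA addNr.
Qed.

Lemma geometric_abs_summable (C s : R[i]) (x : nat -> B) : 0 <= s -> s < 1 ->
  0 <= C -> (forall n, `|x n| <= C * s ^+ n) -> abs_summable x.
Proof.
move=> s0 s1 C0 hx.
exact: bounded_sums_abs_summable hx (bounded_sumsZ C0 (bounded_sums_geometric s0 s1)).
Qed.

Lemma geometric2_abs_summable (C s : R[i]) (x : nat * nat -> B) :
  0 <= s -> s < 1 ->
  0 <= C -> (forall p q, `|x (p, q)| <= C * s ^+ (p + q)) -> abs_summable x.
Proof.
move=> s0 s1 C0 hx; have bs := bounded_sums_geometric s0 s1.
apply: bounded_sums_abs_summable (bounded_sumsZ C0 (bounded_sumsM _ _ bs bs)).
- by move=> [p q]; rewrite /= -exprD.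
- by move=> n; rewrite exprn_ge0.
- by move=> n; rewrite exprn_ge0.
Qed.

Section Bounds.
Variables (C t s : R[i]) (Zl Zr : A) (b d : B).
Hypotheses (C0 : 0 <= C) (t0 : 0 <= t) (ts : t <= s) (s0 : 0 <= s) (s1 : s < 1).
Let X := opL S b * Zl.
Let Y := opR S d * Zr.
Hypothesis bimomentC : forall X' Y' : A, `|X'| <= t -> `|Y'| <= t ->
  forall p q, `|bimoment S X' Y' p q| <= C * t ^+ (p + q).
Hypothesis signed_sumC : forall X' Y' : A, `|X'| <= t -> `|Y'| <= t ->
  forall p q, `|signed_sum S X' Y' p q| <= `|1 : B| * s ^+ (p + q).
Hypotheses (Xt : `|X| <= t) (Yt : `|Y| <= t).

Let bimoment_s X' Y' : `|X'| <= t -> `|Y'| <= t ->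
  forall p q, `|bimoment S X' Y' p q| <= C * s ^+ (p + q).
Proof.
move=> X't Y't p q; apply: le_trans (bimomentC X't Y't p q) _.
by rewrite ler_wpM2l // lerXn2r.
Qed.

Lemma eta_identity :
  transforms_defined S Zl Zr b d /\
  eta_pair S Zl Zr b d =
    etal S Zl b + etar S Zr d
    + (Ml S Zl b)^-1 * M_pair S Zl Zr b d * (Mr S Zr d)^-1 - 1.
Proof.
have z0 : `|0 : A| <= t by rewrite normr0.
have B0 : 0 <= `|1 : B| by [].
pose m n := bimoment S X Y n 0; pose r n := bimoment S X Y 0 n.
pose M u := bimoment S X Y u.1 u.2; pose f u := signed_sum S X Y u.1 u.2.
pose w n := signed_sum S X Y 0 n.
(* The one-variable cumulants have 0 in place of the absent argument, hence [wr] besides [w], and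
   bounds assumed for all [X'] and [Y']. *)
pose wl n := signed_sum S X 0 n 0; pose wr n := signed_sum S 0 Y 0 n.
have ms : abs_summable m.
  apply: (geometric_abs_summable s0 s1 C0) => n.
  by rewrite -[X in s ^+ X]addn0 bimoment_s.
have rs : abs_summable r.
  by apply: (geometric_abs_summable s0 s1 C0) => n; rewrite -[n in s ^+ n]add0n bimoment_s.
have Ms : abs_summable M.
  by apply: (geometric2_abs_summable s0 s1 C0) => p q; rewrite bimoment_s.
have fs : abs_summable f.
  by apply: (geometric2_abs_summable s0 s1 B0) => p q; rewrite signed_sumC.
have ws : abs_summable w.
  by apply: (geometric_abs_summable s0 s1 B0) => n; rewrite -[n in s ^+ n]add0n signed_sumC.
have wls : abs_summable wl.
  by apply: (geometric_abs_summable s0 s1 B0) => n; rewrite -[n in s ^+ n]addn0 signed_sumC.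
have wrs : abs_summable wr.
  by apply: (geometric_abs_summable s0 s1 B0) => n; rewrite -[n in s ^+ n]add0n signed_sumC.
have Msplit : family_sum M = family_sum m + family_sum (fun u => M (u.1, u.2.+1)).
  exact: family_sum_split0.
have Ms' : abs_summable (fun u => M (u.1, u.2.+1)).
  by apply: (@abs_summable_comp _ _ _ _ _ (fun u => (u.1, u.2.+1)) _ Ms) => -[? ?] [? ?] [-> ->].
have Ml_termE : Ml_term S Zl b = fun n => m n.+1.
  by apply/funext => n; rewrite /m /bimoment expr0 mulr1.
have Mr_termE : Mr_term S Zr d = fun n => r n.+1.
  by apply/funext => n; rewrite /r /bimoment expr0 mul1r.
have etal_termE : etal_term S Zl b = fun n => - wl n.+1.
  by apply/funext => n; rewrite /etal_term biBoolean_mnE.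
have etar_termE : etar_term S Zr d = fun n => - wr n.+1.
  by apply/funext => n; rewrite /etar_term biBoolean_mnE.
have M_termE : M_term S Zl Zr b d = fun u => if u == (0%N, 0%N) then 0 else M u.
  exact/funext.
have eta_termE : eta_term S Zl Zr b d = fun u => if u == (0%N, 0%N) then 0 else - f u.
  apply/funext => -[p q]; rewrite /eta_term; case: eqP => // pq.
  by rewrite biBoolean_mnE //; case: p q pq => [|p] [|q].
have absN (I : choiceType) (x : I -> B) : abs_summable x -> abs_summable (fun i => - x i).
  by move=> [N hN]; exists N => J; under eq_fun do rewrite normrN; exact: hN.
have abs0 (x : nat * nat -> B) : abs_summable x ->
    abs_summable (fun u => if u == (0%N, 0%N) then 0 else x u).
  move=> /abs_summableP xs; apply: bounded_sums_abs_summable xs => u.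
  by case: eqP => // _; rewrite normr0.
have shift (x : nat -> B) : abs_summable x -> abs_summable (fun n => x n.+1).
  exact: (abs_summable_comp succn_inj).
(* The leading 1 of a moment series is its term of degree 0. For the cumulants, [signed_sum] is 1 in
   degree 0, so each eta is 1 minus a full sum. *)
have MlE : Ml S Zl b = family_sum m.
  by rewrite /Ml Ml_termE (family_sum_nat_recl ms) /m bimoment00.
have MrE : Mr S Zr d = family_sum r.
  by rewrite /Mr Mr_termE (family_sum_nat_recl rs) /r bimoment00.
have etalE : etal S Zl b = 1 - family_sum wl.
  rewrite /etal etal_termE family_sumN; last exact: shift.
  by rewrite (family_sum_nat_recl wls) /wl signed_sum0 opprD addrA subrr add0r.
have etarE : etar S Zr d = 1 - family_sum wr.
  rewrite /etar etar_termE family_sumN; last exact: shift.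
  by rewrite (family_sum_nat_recl wrs) /wr signed_sum0 opprD addrA subrr add0r.
have M_pairE : M_pair S Zl Zr b d = family_sum M.
  by rewrite /M_pair M_termE family_sum_rem // /M bimoment00 addrC subrK.
have eta_pairE : eta_pair S Zl Zr b d = 1 - family_sum f.
  rewrite /eta_pair eta_termE family_sum_rem; last exact: absN.
  by rewrite family_sumN // /f signed_sum0 opprK addrC.
have m0 : m 0%N = 1 by exact: bimoment00.
have r0 : r 0%N = 1 by exact: bimoment00.
have [mu minv] : family_sum m \is a GRing.unit /\ (family_sum m)^-1 = family_sum wl.
  apply: family_sum_inverse => //; first exact: signed_sum0.
  exact: (signed_sum_left_convolution X 0).
have [ru rinv] : family_sum r \is a GRing.unit /\ (family_sum r)^-1 = family_sum wr.
  apply: family_sum_inverse => //; first exact: signed_sum0.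
  exact: (signed_sum_right_convolution 0 Y).
(* The sums of [w] and [wr] agree because both invert the sum of [r]. *)
have [_ rinv'] : family_sum r \is a GRing.unit /\ (family_sum r)^-1 = family_sum w.
  apply: family_sum_inverse => //; first exact: signed_sum0.
  exact: (signed_sum_right_convolution X Y).
have := family_sum_convolution2 ms ws fs Ms' (@signed_sum_convolution X Y).
have -> : family_sum (fun u => M (u.1, u.2.+1)) = family_sum M - family_sum m.
  by rewrite Msplit addrC addKr.
rewrite -rinv' => conv.
split.
  split; first split.
  - by rewrite Ml_termE; apply: shift.
  - by rewrite Mr_termE; apply: shift.
  - by rewrite etal_termE; apply: absN; apply: shift.
  - by rewrite etar_termE; apply: absN; apply: shift.
  split; rewrite ?MlE ?MrE //.
  - by rewrite M_termE; apply: abs0.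
  - by rewrite eta_termE; apply: abs0; apply: absN.
rewrite eta_pairE etalE etarE MlE MrE M_pairE -minv -rinv.
(* Solving [m f + (M - m) r^-1 = 1] for [f], by cancelling [m] on the left. *)
have -> : family_sum f = (family_sum m)^-1
    - (family_sum m)^-1 * family_sum M * (family_sum r)^-1 + (family_sum r)^-1.
  apply: (mulrI mu); rewrite mulrDr mulrBr !mulrA !divrr // mul1r.
  move/(canRL (addrK _)): conv => ->.
  by rewrite mulrBl opprB addrA addrAC.
set x := (family_sum m)^-1; set y := (family_sum r)^-1; set z := x * _ * y.
have -> : 1 - x + (1 - y) + z - 1 = 1 - x - y + z.
  by rewrite addrAC addrA [_ - y - 1]addrAC addrK.
by rewrite opprD opprB !addrA [1 - x - y + z]addrAC [1 - x + z]addrAC.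
Qed.
End Bounds.
End SmallArguments.

Lemma near0_mul_small (K : numFieldType) (V : normedModType K) (A : banachAlgType K)
    (f : V -> A) (Z : A) (t : K) :
  bounded_map f -> 0 < t -> \forall b \near (0 : V), `|f b * Z| <= t.
Proof.
move=> /bounded_map_ge0[M M0 hM] t0.
(* Adding 1 keeps the divisor positive when [M * |Z|] is 0. *)
have k0 : 0 < M * `|Z| + 1 by rewrite ltr_wpDl ?mulr_ge0.
apply: filterS (nbhs0_lt (divr_gt0 t0 k0)) => b.
rewrite ltr_pdivlMr // => /ltW; apply: le_trans.
apply: le_trans (banach_norm_mul _ _) _.
apply: (@le_trans _ _ (M * `|b| * `|Z|)); first by rewrite ler_wpM2r.
by rewrite mulrAC mulrC ler_wpM2l // lerDl.
Qed.

Unset Implicit Arguments.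

Theorem theorem8p7 (R : realType) (B A : banachAlgType R[i]) (S : ncps B A)
    (hS : banach_ncps S) (Zl Zr : A)
    (hZl : left_face S Zl) (hZr : right_face S Zr) :
  \forall b \near (0 : B) & d \near (0 : B),
    transforms_defined S Zl Zr b d /\
    eta_pair S Zl Zr b d =
      etal S Zl b + etar S Zr d
      + (Ml S Zl b)^-1 * M_pair S Zl Zr b d * (Mr S Zr d)^-1 - 1.
Proof.
case: hS => /bounded_map_ge0[M M0 hM] hL hR.
pose C := M * (`|1 : A| * `|1 : A|).
have C0 : 0 <= C by rewrite !mulr_ge0.
(* From [(2 * C + 2) * x = 1] follows [2 * C * x = 1 - 2 * x <= 1 - x]. The ratio [s] only has to be
   in [(0, 1)], and [t] is the size allowed for [L_b Z_l] and [R_d Z_r]. *)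
pose x := (2 * C + 2)^-1; pose s : R[i] := 2^-1; pose t := s * x.
have k0 : 0 < 2 * C + 2 by rewrite ltr_wpDl ?mulr_ge0.
have x0 : 0 < x by rewrite invr_gt0.
have Cx : 2 * C * x <= 1 - x.
  rewrite lerBrDr -[leRHS](mulfV (lt0r_neq0 k0)) (mulrDl (2 * C)) lerD2l.
  by rewrite ler_peMl ?ler1n // ltW.
have x1 : x < 1.
  by rewrite invf_lt1 // ltr_wpDl ?mulr_ge0 // ltr1n.
have s0 : 0 < s by rewrite invr_gt0.
have s1 : s < 1 by rewrite invf_lt1 // ltr1n.
have t0 : 0 < t by rewrite mulr_gt0.
have ts : t <= s by rewrite ler_piMr // ltW.
have moments X Y (Xt : `|X| <= t) (Yt : `|Y| <= t) := bimoment_bound hM M0 Xt Yt.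
have sums X Y (Xt : `|X| <= t) (Yt : `|Y| <= t) :=
  signed_sum_bound C0 (ltW t0) (ltW s0) (ltW x0) x1 Cx (lexx t) (moments X Y Xt Yt).
have hX := near0_mul_small Zl hL t0.
have hY := near0_mul_small Zr hR t0.
exists ([set b | `|opL S b * Zl| <= t], [set d | `|opR S d * Zr| <= t]) => //.
move=> [b d] [/= bt dt].
exact: (eta_identity C0 (ltW t0) ts (ltW s0) s1 moments sums bt dt).
Qed.
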